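(* Let $\mathbb{F}$ be a finite field, let $1\le k<n$, let $\alpha_1,\dots,\alpha_n\in\mathbb{F}$ be distinct, and let $\tau=\lfloor (n-k)/2\rfloor$. Let $c\in\mathrm{RS}(n,k)$ be a codeword and let $v\in\mathbb{F}^n$ satisfy $\mathrm{wt}(v-c)\le\tau$. Then Decoding Algorithm D (described in the context), run on input $v$, terminates and outputs $h_c$, the unique polynomial of degree less than $k$ whose evaluation vector is $c$.
   Context: Notation. $\mathrm{wt}$ is the Hamming weight. $\mathrm{RS}(n,k)=\{(f(\alpha_1),\dots,f(\alpha_n)): f\in\mathbb{F}[x],\ \deg f<k\}$. Let $\eta=\prod_{j=1}^n(x-\alpha_j)$, $\tilde h_i=\prod_{j\ne i}(x-\alpha_j)$, $h_i=\tilde h_i(\alpha_i)^{-1}\tilde h_i$, and for $w\in\mathbb{F}^n$ let $h_w=\sum_{i=1}^n w_ih_i$ be the Lagrange interpolating polynomial. $\deg$ and $\mathrm{lc}$ denote degree and leading coefficient in $\mathbb{F}[x]$, with $\deg 0=-\infty$. Decoding Algorithm D. The variables $A,B,C,D$ hold polynomials in $\mathbb{F}[x]$. D1. Compute $-h_v=-\sum_{i=1}^n v_ih_i$. D2. Set $A\leftarrow 0$, $B\leftarrow\eta$, $C\leftarrow 1$, $D\leftarrow -h_v$. D3. If $\deg(C)+k-1\ge\deg(D)$, go to D6. D4. Set $d\leftarrow\deg(D)-\deg(B)$ and $\gamma\leftarrow\mathrm{lc}(D)\,\mathrm{lc}(B)^{-1}$. D5. If $d\ge0$, set $C\leftarrow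 C-\gamma x^dA$ and $D\leftarrow D-\gamma x^dB$. If $d<0$, simultaneously replace $(A,B,C,D)$ by $(C,\;D,\;x^{-d}C-\gamma A,\;x^{-d}D-\gamma B)$ (old values on the right). Go to D3. D6. Output $-D/C$ and stop. *)

(* Defs.v *)
From HB Require Import structures.
From mathcomp Require Import all_boot all_order all_algebra.
From mathcomp Require Import constructive_ereal.

Set Implicit Arguments.
Unset Strict Implicit.
Unset Printing Implicit Defensive.

Import Order.TTheory GRing.Theory Num.Theory.
Local Open Scope ring_scope.

(* The degree with deg 0 = -oo; the values lie in the extended integers. *)
Definition deg (R : nzRingType) (p : {poly R}) : \bar int :=
  if p == 0 then -oo%E else ((size p).-1%:Z)%:E.

Definition wt (F : fieldType) (n : nat) (w : 'rV[F]_n) : nat :=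
  #|[set i | w 0 i != 0]|.

Definition RS (F : fieldType) (n : nat) (alpha : 'I_n -> F) (k : nat)
    (c : 'rV[F]_n) : Prop :=
  exists f : {poly F}, (deg f < k%:Z%:E)%E /\ c = \row_i f.[alpha i].

Section Interpolation.
Variables (F : fieldType) (n : nat) (alpha : 'I_n -> F).

Definition eta_poly : {poly F} := \prod_(j < n) ('X - (alpha j)%:P).

Definition h_tilde (i : 'I_n) : {poly F} :=
  \prod_(j < n | j != i) ('X - (alpha j)%:P).

Definition h_basis (i : 'I_n) : {poly F} :=
  (h_tilde i).[alpha i]^-1 *: h_tilde i.

Definition h_interp (w : 'rV[F]_n) : {poly F} :=
  \sum_(i < n) w 0 i *: h_basis i.

End Interpolation.

Section Decoder.
Variable F : fieldType.

(* [Failed] is entered exactly where the algorithm would divide by zero: when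
   lc(B)^-1 is needed for B = 0, or when -D/C is to be output for C = 0.
   The output -D/C is an element of the field of rational functions. *)
Inductive config :=
  | Running of {poly F} & {poly F} & {poly F} & {poly F}
  | Output of {fraction {poly F}}
  | Failed.

(* One pass through the loop.  If the stopping test fails then D is nonzero,
   so [d] is a difference of finite degrees as soon as B is nonzero. *)
Definition decode_step (k : nat) (s : config) : config :=
  if s is Running A B C D then
    if (deg D <= deg C + (k%:Z - 1)%:E)%E then
      if C == 0 then Failed else Output (- tofrac D / tofrac C)
    else if B == 0 then Failed
    else
      let d : int := fine (deg D - deg B)%E in
      let g : F := lead_coef D * (lead_coef B)^-1 in
      if 0 <= d
      then Running A B (C - g *: ('X^`|d|%N * A)) (D - g *: ('X^`|d|%N * B))
      else Running C D ('X^`|d|%N * C - g *: A) ('X^`|d|%N * D - g *: B)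
  else s.

Definition decode_init (n : nat) (alpha : 'I_n -> F) (v : 'rV[F]_n) : config :=
  Running 0 (eta_poly alpha) 1 (- h_interp alpha v).

(* [Output] and [Failed] are fixed points of [decode_step], so there is at
   most one such q, and there is none if the run fails or does not halt. *)
Definition decoder_outputs (n k : nat) (alpha : 'I_n -> F) (v : 'rV[F]_n)
    (q : {fraction {poly F}}) : Prop :=
  exists m : nat, iter m (decode_step k) (decode_init alpha v) = Output q.

End Decoder.

(* Main.v *)
Require Import Defs.
From mathcomp Require Import all_boot all_order all_algebra.
From mathcomp Require Import constructive_ereal.
From mathcomp Require Import zify ring.

Set Implicit Arguments.
Unset Strict Implicit.
Unset Printing Implicit Defensive.

Import Order.TTheory GRing.Theory Num.Theory.
Local Open Scope ring_scope.

(** Every pair [(P, Q)] among [(A, B)] and [(C, D)] satisfies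
    [Q = - h_v P] modulo [eta].  If [L] is the error locator, then so does
    [(L, - L h_c)]; eliminating [h_v], [eta] divides [L (Q + h_c P)], so that
    [Q = - h_c P] as soon as [P] and [Q] have small degrees.  Along the run
    [deg A + k - 1 < deg B], which forbids [B = - h_c A], hence
    [deg B >= k + tau]; as [deg B + deg C = n] throughout, this bounds [deg C],
    and when the loop stops it also bounds [deg D], so [D = - h_c C].  The loop
    stops because [deg B + deg D] decreases at each step. *)

(* Rewriting with library lemmas leaves occurrences of [size p] that differ in
   the coercion path of the coefficient ring; [lia] would take them for distinct
   atoms, whereas [move: (size p)] identifies them up to conversion. *)
Ltac size_lia :=
  repeat match goal with
  | H : is_true (leq _ _) |- _ => generalize H; clear H
  | H : @eq nat _ _ |- _ => generalize H; clear H
  end;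
  repeat match goal with |- context [@size ?T ?s] => move: (@size T s) end;
  lia.

(** * Degrees in extended integers, translated into sizes *)

Section Degree.
Variable R : nzRingType.
Implicit Types p q : {poly R}.

Lemma deg_neq0 p : p != 0 -> deg p = ((size p).-1%:Z)%:E.
Proof. by rewrite /deg => /negPf ->. Qed.

Lemma deg_lt_nat p k : (deg p < k%:Z%:E)%E = (size p <= k)%N.
Proof.
rewrite /deg; case: (eqVneq p 0) => [->|p0]; first by rewrite size_poly0 ltNyr.
by rewrite lte_fin; move: p0; rewrite -size_poly_gt0; size_lia.
Qed.

(** This serves the stopping test, with [D] as [p] and [C] as [q]. As [q] is nonzero its degree is
    finite, and a zero [p] passes the test on both sides. *)
Lemma deg_le_addn p q k : (0 < k)%N -> q != 0 ->
  (deg p <= deg q + (k%:Z - 1)%:E)%E = (size p < size q + k)%N.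
Proof.
move=> k0 q0; rewrite (deg_neq0 q0) /deg.
case: (eqVneq p 0) => [->|p0].
  by rewrite leNye size_poly0 addn_gt0 k0 orbT.
rewrite -EFinD lee_fin; move: p0 q0; rewrite -!size_poly_gt0; size_lia.
Qed.

Lemma fine_degB p q : p != 0 -> q != 0 ->
  fine (deg p - deg q)%E = (size p)%:Z - (size q)%:Z.
Proof.
move=> p0 q0; rewrite !deg_neq0 // -EFinN -EFinD /=.
move: p0 q0; rewrite -!size_poly_gt0; size_lia.
Qed.

End Degree.

(** * Lagrange interpolation and the error locator *)

Section Lagrange.
Variables (F : fieldType) (n : nat) (alpha : 'I_n -> F).
Hypothesis alpha_inj : injective alpha.

Lemma size_eta_poly : size (eta_poly alpha) = n.+1.
Proof.
by rewrite /eta_poly size_prod_XsubC /index_enum -enumT size_enum_ord.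
Qed.

Lemma eta_poly_dvd (p : {poly F}) :
  (forall i, p.[alpha i] = 0) -> eta_poly alpha %| p.
Proof.
move=> p_alpha; rewrite /eta_poly -(big_map alpha xpredT (fun z => 'X - z%:P)).
apply: uniq_roots_dvdp.
  by apply/allP => z /mapP[i _ ->]; apply/rootP.
by rewrite uniq_rootsE map_inj_uniq // /index_enum -enumT enum_uniq.
Qed.

Lemma eq_poly_on_nodes (p q : {poly F}) : (size p <= n)%N -> (size q <= n)%N ->
  (forall i, p.[alpha i] = q.[alpha i]) -> p = q.
Proof.
move=> sp sq pq; apply/eqP; rewrite -subr_eq0.
have dvd : eta_poly alpha %| p - q.
  by apply: eta_poly_dvd => i; rewrite hornerD hornerN pq subrr.
apply: contraTT dvd => nz; apply/negP => /(dvdp_leq nz).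
rewrite size_eta_poly => /leq_trans/(_ (size_polyD _ _)).
by rewrite size_polyN ltnNge geq_max sp sq.
Qed.

Lemma size_h_tilde i : (size (h_tilde alpha i) <= n)%N.
Proof.
rewrite /h_tilde -big_filter size_prod_XsubC -sum1_size big_filter.
(* The size is [n.-1.+1], which is [n] because the existence of [i] forces [n] to be positive. *)
by rewrite sum1_card (cardC1 i) card_ord; have := ltn_ord i; size_lia.
Qed.

Lemma size_h_interp w : (size (h_interp alpha w) <= n)%N.
Proof.
apply: (leq_trans (size_sum _ _ _)); apply/bigmax_leqP => i _.
rewrite /h_basis scalerA.
exact: leq_trans (size_scale_leq _ _) (size_h_tilde i).
Qed.

Lemma horner_h_basis i j : (h_basis alpha i).[alpha j] = (i == j)%:R.
Proof.
have val_tilde m : (h_tilde alpha i).[alpha m]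
    = \prod_(l < n | l != i) (alpha m - alpha l).
  by rewrite horner_prod; apply: eq_bigr => l _; rewrite hornerXsubC.
rewrite /h_basis hornerZ; case: eqVneq => [<-|ij].
  rewrite mulVf // val_tilde; apply/prodf_neq0 => l li.
  by rewrite subr_eq0 (inj_eq alpha_inj) eq_sym.
by rewrite (val_tilde j) (bigD1 j) 1?eq_sym //= subrr mul0r mulr0.
Qed.

Lemma horner_h_interp w i : (h_interp alpha w).[alpha i] = w 0 i.
Proof.
rewrite /h_interp horner_sum (bigD1 i) //= hornerZ horner_h_basis eqxx mulr1.
by rewrite big1 ?addr0 // => j /negPf ji; rewrite hornerZ horner_h_basis ji mulr0.
Qed.

Definition error_locator (e : 'rV[F]_n) : {poly F} :=
  \prod_(i | e 0 i != 0) ('X - (alpha i)%:P).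

Lemma size_error_locator e : size (error_locator e) = (wt e).+1.
Proof.
rewrite /error_locator -big_filter size_prod_XsubC -sum1_size big_filter.
by rewrite sum1_card /wt cardsE.
Qed.

(** At an error-free node [h_v] and [f] agree; at every other node the locator vanishes. *)
Lemma error_locator_dvd (c v : 'rV[F]_n) (f : {poly F}) :
  (forall i, f.[alpha i] = c 0 i) ->
  eta_poly alpha %| error_locator (v - c) * (h_interp alpha v - f).
Proof.
move=> fc; apply: eta_poly_dvd => i.
rewrite hornerM hornerD hornerN horner_h_interp fc.
case: (eqVneq ((v - c) 0 i) 0) => [|nz]; first by rewrite !mxE => ->; rewrite mulr0.
by rewrite /error_locator horner_prod (bigD1 i) //= hornerXsubC subrr !mul0r.
Qed.

End Lagrange.

(** * Cancellation of leading terms *)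

Section CancelLead.
Variables (F : fieldType).
Implicit Types p q : {poly F}.

Lemma size_scaleXn_leq (a : F) d p : (size (a *: ('X^d * p)) <= d + size p)%N.
Proof.
apply: (leq_trans (size_scale_leq _ _)).
by rewrite (leq_trans (size_polyMleq _ _)) // size_polyXn.
Qed.

Lemma size_Xn_mul d p : p != 0 -> size ('X^d * p) = (d + size p)%N.
Proof. by move=> p0; rewrite mulrC size_mulXn. Qed.

Lemma size_subr_lead p q : p != 0 -> size p = size q ->
  lead_coef p = lead_coef q -> (size (p - q)%R < size p)%N.
Proof.
move=> p0 spq lpq; have sp : (0 < size p)%N by rewrite size_poly_gt0.
rewrite -[X in (_ < X)%N](prednK sp) ltnS; apply/leq_sizeP => j.
rewrite leq_eqVlt coefB (prednK sp) => /orP[/eqP <-|lej].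
  by rewrite -/(lead_coef p) lpq spq -/(lead_coef q) subrr.
by rewrite !nth_default ?subrr // -spq.
Qed.

End CancelLead.

(** * Small solutions of the key equation *)

Section KeyEquation.
Variables (F : fieldType) (eta h f L : {poly F}) (k tau : nat).
Hypotheses (L0 : L != 0) (sL : (size L <= tau.+1)%N) (sf : (size f <= k)%N).
Hypothesis locator : eta %| L * (h - f).

(** Multiplying by [L] adds at most [tau] to the size, and [f * P] has size at most [size P + k - 1]
    when [P] is nonzero. Under both bounds [L * (Q + f * P)] is thus a multiple of [eta] of smaller
    degree, hence zero. *)
Lemma key_equation_sol (P Q : {poly F}) :
  eta %| Q + h * P -> (size P + k + tau <= size eta)%N ->
  (size Q + tau < size eta)%N -> Q = - (f * P).
Proof.
move=> dPQ sP sQ.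
have dvd : eta %| L * (Q + f * P).
  have -> : L * (Q + f * P) = L * (Q + h * P) - L * (h - f) * P by ring.
  by apply: dvdp_sub; [apply: dvdp_mull | apply: dvdp_mulr].
apply/eqP; rewrite -addr_eq0; apply: contraTT dvd => nz.
have LS0 : L * (Q + f * P) != 0 by rewrite mulf_neq0.
apply/negP => /(dvdp_leq LS0).
rewrite size_mul //.
have := size_polyD Q (f * P); have := size_polyMleq f P.
move: nz L0; rewrite -!size_poly_gt0.
case: (eqVneq P 0) => [->|]; first by rewrite mulr0 size_poly0; size_lia.
rewrite -size_poly_gt0; size_lia.
Qed.

End KeyEquation.

(** * Invariants of the loop *)

Section Run.
Variables (F : fieldType) (n k : nat) (alpha : 'I_n -> F) (v : 'rV[F]_n).
Hypothesis k0 : (0 < k)%N.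

Let eta := eta_poly alpha.
Let h := h_interp alpha v.

Record decoder_inv (A B C D : {poly F}) : Prop := DecoderInv {
  inv_dvdB : eta %| B + h * A;
  inv_dvdD : eta %| D + h * C;
  inv_sizeBC : (size B + size C = n.+2)%N;
  inv_sizeAD : (size A + size D < n.+2)%N;
  inv_sizeAB : (size A + k <= size B)%N;
  inv_C0 : C != 0 }.

Lemma decoder_inv_init : (k <= n)%N ->
  decoder_inv 0 (eta_poly alpha) 1 (- h_interp alpha v).
Proof.
move=> kn; split; rewrite ?mulr0 ?addr0 ?mulr1 ?addNr ?dvdp0 ?oner_eq0 //.
- by rewrite size_eta_poly size_poly1 addn1.
- by rewrite size_poly0 size_polyN ltnW // !ltnS size_h_interp.
- by rewrite size_poly0 size_eta_poly ltnW.
Qed.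

Variables A B C D : {poly F}.
Hypothesis invs : decoder_inv A B C D.

Lemma inv_B0 : B != 0.
Proof. by rewrite -size_poly_gt0; have := inv_sizeAB invs; size_lia. Qed.

Lemma decode_step_stop : (size D < size C + k)%N ->
  decode_step k (Running A B C D) = Output (- tofrac D / tofrac C).
Proof.
move=> lt.
by rewrite /= deg_le_addn ?(inv_C0 invs) // lt (negPf (inv_C0 invs)).
Qed.

(** The step applies one combination over F[x] to both entries of the pairs, so the congruences
    persist. With [inv_sizeBC], [inv_sizeAD] says that the multiple of [A] being subtracted is too
    short to touch the leading term of [C] or of its shift. After a swap, the failed stopping test
    is exactly the new [inv_sizeAB]. *)
Lemma decode_step_continue : (size C + k <= size D)%N ->
  exists A' B' C' D', [/\
    decode_step k (Running A B C D) = Running A' B' C' D',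
    decoder_inv A' B' C' D' &
    (size B' + size D' < size B + size D)%N].
Proof.
case: (invs) => dB dD sBC sAD sAB C0 sCD; have B0 := inv_B0.
have D0 : D != 0 by rewrite -size_poly_gt0; size_lia.
have lB0 : lead_coef B != 0 by rewrite lead_coef_eq0.
have lD0 : lead_coef D != 0 by rewrite lead_coef_eq0.
rewrite /= deg_le_addn // ltnNge sCD /= (negPf B0) fine_degB // subr_ge0.
set g := _ * _^-1; set d := absz _.
have g0 : g != 0 by rewrite mulf_neq0 ?invr_eq0.
have lg : g * lead_coef B = lead_coef D by rewrite /g mulfVK.
rewrite lez_nat; case: (leqP (size B) (size D)) => sBD.
- have dE : (d + size B = size D)%N by rewrite /d; size_lia.
  have sC' : size (C - g *: ('X^d * A)) = size C.
    rewrite size_polyDl // size_polyN.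
    by apply: leq_ltn_trans (size_scaleXn_leq _ _ _) _; size_lia.
  have sD' : (size (D - g *: ('X^d * B))%R < size D)%N.
    apply: size_subr_lead => //.
      by rewrite size_scale // size_Xn_mul.
    by rewrite lead_coefZ lead_coefM lead_coefXn mul1r lg.
  exists A, B, (C - g *: ('X^d * A)), (D - g *: ('X^d * B)); split=> //.
    split=> //; rewrite ?sC' //; first last.
    + by rewrite -size_poly_gt0 sC' size_poly_gt0.
    + size_lia.
    have -> : D - g *: ('X^d * B) + h * (C - g *: ('X^d * A))
        = (D + h * C) - (g *: 'X^d) * (B + h * A).
      by rewrite -!mul_polyC; ring.
    by apply: dvdp_sub => //; apply: dvdp_mull.
  by rewrite ltn_add2l.
have dE : (d + size D = size B)%N by rewrite /d; size_lia.
have sC' : size ('X^d * C - g *: A) = (d + size C)%N.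
  rewrite size_polyDl size_Xn_mul // size_polyN size_scale //; size_lia.
have sD' : (size ('X^d * D - g *: B)%R < size B)%N.
  rewrite -[X in (_ < X)%N]dE -size_Xn_mul //; apply: size_subr_lead.
  - by rewrite mulf_neq0 // -size_poly_gt0 size_polyXn.
  - by rewrite size_Xn_mul // size_scale.
  - by rewrite lead_coefZ lead_coefM lead_coefXn mul1r lg.
exists C, D, ('X^d * C - g *: A), ('X^d * D - g *: B); split=> //; last size_lia.
split=> //; rewrite ?sC'; [|size_lia|size_lia|].
  have -> : 'X^d * D - g *: B + h * ('X^d * C - g *: A)
      = 'X^d * (D + h * C) - g%:P * (B + h * A).
    by rewrite -!mul_polyC; ring.
  by apply: dvdp_sub; apply: dvdp_mull.
by rewrite -size_poly_gt0 sC' addn_gt0 size_poly_gt0 C0 orbT.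
Qed.

End Run.

(** * Correctness within the decoding radius *)

Section Decoding.
Variables (F : fieldType) (n k : nat) (alpha : 'I_n -> F).
Hypotheses (alpha_inj : injective alpha) (k0 : (0 < k)%N) (kn : (k <= n)%N).
Variables (c v : 'rV[F]_n) (f : {poly F}).
Hypotheses (sf : (size f <= k)%N) (fc : forall i, f.[alpha i] = c 0 i).
Hypothesis few_errors : (wt (v - c) <= (n - k) %/ 2)%N.

Lemma codeword_sol (P Q : {poly F}) :
  eta_poly alpha %| Q + h_interp alpha v * P ->
  (size P + k + (n - k) %/ 2 <= n.+1)%N ->
  (size Q + (n - k) %/ 2 <= n)%N -> Q = - (f * P).
Proof.
move=> dvd sP sQ.
apply: (key_equation_sol _ _ sf (error_locator_dvd alpha_inj _ fc) dvd
          (tau := (n - k) %/ 2)); rewrite ?size_eta_poly //.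
- by rewrite -size_poly_gt0 size_error_locator.
- by rewrite size_error_locator.
Qed.

Lemma inv_sizeB_gt A B C D : decoder_inv k alpha v A B C D ->
  (k + (n - k) %/ 2 < size B)%N.
Proof.
case=> dB _ _ _ sAB _; rewrite ltnNge; apply/negP => sB.
(* With [tau] for [(n - k) %/ 2], twice [tau] is at most [n - k], so
   [size B + tau <= k + 2 tau <= n]; [inv_sizeAB] then bounds [size A] as well. *)
have half := leq_divM (n - k) 2.
have BE : B = - (f * A) by apply: codeword_sol => //; size_lia.
move: sAB; rewrite BE size_polyN; have := size_polyMleq f A.
case: (eqVneq A 0) => [->|]; first by rewrite mulr0 size_poly0; size_lia.
rewrite -size_poly_gt0; size_lia.
Qed.

Lemma inv_stop A B C D : decoder_inv k alpha v A B C D ->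
  (size D < size C + k)%N -> D = - (f * C).
Proof.
move=> invs sDC; have := inv_sizeB_gt invs; have := inv_sizeBC invs.
(* Here [size C <= n + 1 - k - tau], and the stopping test turns this into [size D <= n - tau]. *)
by move=> sBC sB; apply: codeword_sol (inv_dvdD invs) _ _; size_lia.
Qed.

Lemma decode_run A B C D : decoder_inv k alpha v A B C D ->
  exists m, iter m (decode_step k) (Running A B C D) = Output (tofrac f).
Proof.
have [N le_N] := ubnP (size B + size D).
elim: N => // N IHN in A B C D le_N * => invs.
case: (ltnP (size D) (size C + k)) => sDC.
  exists 1%N; rewrite /iter (decode_step_stop k0 invs) //.
  rewrite {1}(inv_stop invs sDC) rmorphN opprK rmorphM mulfK //.
  by rewrite tofrac_eq0 (inv_C0 invs).
have [A' [B' [C' [D' [stepE invs' lt]]]]] := decode_step_continue k0 invs sDC.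
have [|m runE] := IHN A' B' C' D' _ invs'; first by lia.
by exists m.+1; rewrite iterSr stepE.
Qed.

Lemma decoder_correct : decoder_outputs k alpha v (tofrac f).
Proof. by apply: decode_run; apply: decoder_inv_init. Qed.

End Decoding.

Theorem mainTheorem2 (F : finFieldType) (n k : nat)
  (hk : (1 <= k)%N) (hkn : (k < n)%N)
  (alpha : 'I_n -> F) (halpha : injective alpha)
  (c v : 'rV[F]_n) (hc : RS alpha k c)
  (hv : (wt (v - c) <= (n - k) %/ 2)%N) :
  decoder_outputs k alpha v (tofrac (h_interp alpha c)) /\
  (deg (h_interp alpha c) < k%:Z%:E)%E /\
  (forall i : 'I_n, (h_interp alpha c).[alpha i] = c 0 i) /\
  (forall p : {poly F}, (deg p < k%:Z%:E)%E ->
     (forall i : 'I_n, p.[alpha i] = c 0 i) -> p = h_interp alpha c).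
Proof.
have hkn' := ltnW hkn.
have uniq_h (p : {poly F}) : (size p <= k)%N ->
    (forall i, p.[alpha i] = c 0 i) -> p = h_interp alpha c.
  move=> sp pc; apply: (eq_poly_on_nodes halpha).
  - exact: leq_trans sp hkn'.
  - exact: size_h_interp.
  - by move=> i; rewrite pc horner_h_interp.
case: hc => f [degf cE]; rewrite deg_lt_nat in degf.
have fc i : f.[alpha i] = c 0 i by rewrite cE mxE.
(* By uniqueness the message polynomial [f] is [h_c], so the decoder's output can be stated with
   [f]. *)
rewrite -(uniq_h f degf fc) deg_lt_nat; split; last split=> //.
  exact (decoder_correct halpha hk hkn' degf fc hv).
by split=> // p; rewrite deg_lt_nat (uniq_h f degf fc); apply: uniq_h.
Qed.
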